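(* Consider Dirichlet boundary conditions on $\partial\Omega$ and let $h=\min\{\Delta x,\Delta y\}$. Let $\gamma=1$ for the iterative IMEX-I Euler method and $\gamma=\frac32$ for the iterative IMEX-I 2SBDF method. The iterations defining the iterative IMEX-I Euler method, and the iterations defining the iterative IMEX-I 2SBDF method, converge if $$\left(h^2>\frac{8D_\phi}{w}\quad\text{or}\quad \Delta t<\frac{\gamma h^2}{8D_\phi-wh^2}\right)\quad\text{and}\quad \Delta t<\frac{\gamma h^2}{8D_c}.$$
   Context: Let $\Omega=[0,L_x]\times[0,L_y]$, let $\Theta$ be a set contained in the interior of $\Omega$ (the union of the holes), and $\widehat\Omega=\Omega\setminus\Theta$. The grid has nodes $(x_i,y_j)=(i\Delta x,j\Delta y)$, $1\le i\le m_x$, $1\le j\le m_y$, with $\Delta x=L_x/(m_x+1)$, $\Delta y=L_y/(m_y+1)$, ordered lexicographically (the node $(x_i,y_j)$ has index $i+(j-1)m_x$); $\Theta$ contains at least one grid node. The discrete Dirichlet Laplacian is $\mathcal M=I_{m_y}\otimes\mathcal M_x+\mathcal M_y\otimes I_{m_x}$, where for $r\in\{x,y\}$ the $m_r\times m_r$ matrix $\mathcal M_r$ is $\frac{1}{\Delta r^2}$ times the tridiagonal matrix with $-2$ on the diagonal and $1$ on the sub- and superdiagonal. The matrices $\mathcal N_1,\mathcal N_2$ have entries: $(\mathcal N_1)_{p,q}=\mathcal M_{p,q}$ if node $p$ is in $\Theta$ and node $q$ is in $\widehat\Omega$, and $0$ otherwise; $(\mathcal N_2)_{p,q}=\mathcal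 M_{p,q}$ if node $q$ is in $\Theta$, and $0$ otherwise. The constants $D_\phi,D_c,w,\Delta t$ are positive. For the IMEX-I methods put $\mathcal N=\mathcal N_1+\mathcal N_2$. At each time step the iterative Euler method consists of the two iterations in $k=0,1,2,\dots$ $$((1+w\Delta t)I-\Delta tD_\phi\mathcal M)\boldsymbol\phi^{n+1,k+1}=-\Delta tD_\phi\mathcal N\boldsymbol\phi^{n+1,k}+\mathbf g_\phi,\qquad (I-\Delta tD_c\mathcal M)\mathbf c^{n+1,k+1}=-\Delta tD_c\mathcal N\mathbf c^{n+1,k}+\mathbf g_c,$$ and the iterative 2SBDF method of the two iterations $$((3+2w\Delta t)I-2\Delta tD_\phi\mathcal M)\boldsymbol\phi^{n+2,k+1}=-2\Delta tD_\phi\mathcal N\boldsymbol\phi^{n+2,k}+\mathbf g_\phi,\qquad (3I-2\Delta tD_c\mathcal M)\mathbf c^{n+2,k+1}=-2\Delta tD_c\mathcal N\mathbf c^{n+2,k}+\mathbf g_c,$$ where $\mathbf g_\phi,\mathbf g_c$ are known vectors built from already computed quantities and independent of $k$. Convergence means convergence of the sequences as $k\to\infty$ for every starting iterate. *)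

(* Defs.v *)
From mathcomp Require Import all_boot all_order all_algebra.
From mathcomp Require Import all_classical all_reals all_analysis.
From mathcomp Require Import mxtens.

Set Implicit Arguments.
Unset Strict Implicit.
Unset Printing Implicit Defensive.

Import Order.TTheory GRing.Theory Num.Theory.
Import numFieldNormedType.Exports.

Local Open Scope classical_set_scope.
Local Open Scope ring_scope.

Section Grid.
Context {R : realType}.
Variables (Lx Ly : R) (mx my : nat) (Theta : set (R * R)).

Definition Omega : set (R * R) := `[0, Lx] `*` `[0, Ly].

Definition hatOmega : set (R * R) := Omega `\` Theta.

Definition gridstep (L : R) (m : nat) : R := L / m.+1%:R.

(* Unknowns are indexed by 'I_(my * mx).  [mxtens_unindex p] is the pair
   (p %/ mx, p %% mx), so it is the zero-based pair (j - 1, i - 1) for which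
   p + 1 = i + (j - 1) mx: the lexicographic ordering of the nodes. *)
Definition node (p : 'I_(my * mx)) : R * R :=
  ((mxtens_unindex p).2.+1%:R * gridstep Lx mx,
   (mxtens_unindex p).1.+1%:R * gridstep Ly my).

Definition laplace1d (m : nat) (d : R) : 'M[R]_m :=
  (d ^+ 2)^-1 *:
  \matrix_(i < m, j < m)
     (if i == j then - 2
      else if (i.+1 == j :> nat) || (j.+1 == i :> nat) then 1 else 0).

Definition dirichlet_laplacian : 'M[R]_(my * mx) :=
  1%:M *t laplace1d mx (gridstep Lx mx)
  + laplace1d my (gridstep Ly my) *t 1%:M.

Definition calN1 : 'M[R]_(my * mx) :=
  \matrix_(p, q)
     if (node p \in Theta) && (node q \in hatOmega)
     then dirichlet_laplacian p q else 0.

Definition calN2 : 'M[R]_(my * mx) :=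
  \matrix_(p, q) if node q \in Theta then dirichlet_laplacian p q else 0.

Definition calN : 'M[R]_(my * mx) := calN1 + calN2.

End Grid.

Section Iterations.
Context {R : realType}.

Definition is_iteration n (A B : 'M[R]_n) (g : 'cV[R]_n)
    (u0 : 'cV[R]_n) (u : nat -> 'cV[R]_n) : Prop :=
  u 0%N = u0 /\ forall k, A *m u k.+1 = B *m u k + g.

(* The scheme A u^{k+1} = B u^k + g is implicit, so convergence includes that
   every starting iterate determines one and only one sequence. *)
Definition iteration_converges n (A B : 'M[R]_n) : Prop :=
  forall g u0 : 'cV[R]_n,
  exists u : nat -> 'cV[R]_n, unique (is_iteration A B g u0) u /\ cvgn u.

Variables (n : nat) (M N : 'M[R]_n) (Dphi Dc w dt : R).

Definition euler_converges : Prop :=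
  iteration_converges ((1 + w * dt)%:M - (dt * Dphi) *: M)
                      (- ((dt * Dphi) *: N))
  /\ iteration_converges (1%:M - (dt * Dc) *: M) (- ((dt * Dc) *: N)).

Definition sbdf2_converges : Prop :=
  iteration_converges ((3 + 2 * w * dt)%:M - (2 * dt * Dphi) *: M)
                      (- ((2 * dt * Dphi) *: N))
  /\ iteration_converges (3%:M - (2 * dt * Dc) *: M)
                         (- ((2 * dt * Dc) *: N)).

End Iterations.

(* In the critical case h^2 = 8 Dphi / w the denominator below is 0, and so is
   the quotient: the disjunction is then false for dt > 0. *)
Definition step_condition {R : realType} (gamma h Dphi Dc w dt : R) : Prop :=
  (8 * Dphi / w < h ^+ 2
   \/ dt < gamma * h ^+ 2 / (8 * Dphi - w * h ^+ 2))
  /\ dt < gamma * h ^+ 2 / (8 * Dc).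

(* Main.v *)
Require Import Defs.
From mathcomp Require Import all_boot all_order all_algebra.
From mathcomp Require Import all_classical all_reals all_analysis.
From mathcomp Require Import mxtens ring lra.
Import Order.TTheory GRing.Theory Num.Theory.
Import numFieldNormedType.Exports.
Local Open Scope classical_set_scope.
Local Open Scope ring_scope.

(** Write [L = - M], let [P] be the diagonal projection onto the nodes outside
    the holes, and let [c = 8 / h ^+ 2].  Every node lies in [Omega], so each
    entry [(p, q)] of [M] with [p] or [q] in a hole is counted exactly once
    by [N1 + N2], whence [N = M - P M P] ([calNE]).  All four iterations
    therefore have the form [A u' = B u + g] with [A = a + t L] and
    [B = t (L - P L P)], where [t] is the time step times the diffusivity,
    doubled for 2SBDF, and each step restriction gives [t c < a].

    In the order of symmetric matrices, [0 <= L <= c]: shifting [M] by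
    [c0 = 2 / dx ^+ 2 + 2 / dy ^+ 2], the opposite of its diagonal entry,
    leaves a nonnegative matrix with row sums at most [c0], and
    the Gershgorin bound gives [- c0 <= M + c0 <= c0]
    ([dirichlet_laplacian_psd]).  The compression [P L P] inherits these
    bounds, so that
      [A - B = a + t P L P >= a > 0] and
      [A + B = 2 t L + (a - t P L P) >= a - t c > 0].

    These two inequalities suffice for convergence
    ([iteration_converges_of_psd]).  If [e] is the error of an iterate and [d]
    the increment to the next one, then [A d = - (A - B) e], and hence the
    energy <(A - B) e, e> drops by exactly <(A + B) d, d> at each step.  Being
    nonnegative, the energy converges; so [d] tends to 0, and with it
    [e = - (A - B)^-1 A d]. *)

(** * Quadratic forms and positive semidefinite matrices *)

Definition qform {R : pzRingType} {n : nat} (A : 'M[R]_n) (x : 'cV[R]_n) : R :=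
  (x^T *m A *m x) 0 0.

(** A condition on the quadratic form alone; [psd (A - B)] serves as the
    relation [B <= A] between quadratic forms. *)
Definition psd {R : numDomainType} {n : nat} (A : 'M[R]_n) : Prop :=
  forall x, 0 <= qform A x.

Definition abs_row_sum {R : numDomainType} {m n : nat} (A : 'M[R]_(m, n))
  (i : 'I_m) : R := \sum_j `|A i j|.

Section QuadraticForms.
Context {R : comPzRingType} {n : nat}.
Implicit Types (A B P : 'M[R]_n) (x y : 'cV[R]_n).

Lemma qformE A x : qform A x = \sum_i \sum_j A i j * (x i 0 * x j 0).
Proof.
rewrite /qform -mulmxA mxE; apply: eq_bigr => i _.
rewrite !mxE mulr_sumr; apply: eq_bigr => j _; ring.
Qed.

Lemma qformD A B x : qform (A + B) x = qform A x + qform B x.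
Proof. by rewrite /qform mulmxDr mulmxDl mxE. Qed.

Lemma qformZ c A x : qform (c *: A) x = c * qform A x.
Proof. by rewrite /qform -scalemxAr -scalemxAl mxE. Qed.

Lemma qformN A x : qform (- A) x = - qform A x.
Proof. by rewrite -scaleN1r qformZ mulN1r. Qed.

Lemma qform_scalar c x : qform c%:M x = c * \sum_i x i 0 ^+ 2.
Proof.
rewrite -scalemx1 qformZ /qform mulmx1 mxE; congr (_ * _).
by apply: eq_bigr => i _; rewrite mxE expr2.
Qed.

Lemma qform_congr A P x : qform (P^T *m A *m P) x = qform A (P *m x).
Proof. by rewrite /qform trmx_mul !mulmxA. Qed.

Lemma qform_add A x y : A^T = A ->
  qform A (x + y) = qform A x + 2 * (y^T *m A *m x) 0 0 + qform A y.
Proof.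
move=> symA; have crossE : (x^T *m A *m y) 0 0 = (y^T *m A *m x) 0 0.
  have -> : x^T *m A *m y = (y^T *m A *m x)^T.
    by rewrite !trmx_mul trmxK symA mulmxA.
  by rewrite mxE.
have entryD (U V : 'M[R]_1) : (U + V) 0 0 = U 0 0 + V 0 0 by rewrite mxE.
rewrite /qform [(x + y)^T]raddfD /= !mulmxDl !mulmxDr !entryD crossE; ring.
Qed.

End QuadraticForms.

Section PositiveSemidefinite.
Context {R : realDomainType} {n : nat}.
Implicit Types (A B P S : 'M[R]_n).

Lemma psdD A B : psd A -> psd B -> psd (A + B).
Proof. by move=> hA hB x; rewrite qformD addr_ge0. Qed.

Lemma psdZ c A : 0 <= c -> psd A -> psd (c *: A).
Proof. by move=> c0 hA x; rewrite qformZ mulr_ge0. Qed.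

Lemma psd_scalar c : 0 <= c -> psd (c%:M : 'M[R]_n).
Proof.
by move=> c0 x; rewrite qform_scalar mulr_ge0// sumr_ge0// => i _; exact: sqr_ge0.
Qed.

Lemma psd_congr A P : psd A -> psd (P^T *m A *m P).
Proof. by move=> hA x; rewrite qform_congr. Qed.

(** Since [2 |x i x j| <= x i ^+ 2 + x j ^+ 2], the form of [S] is at most
    the sum of [|S i j| (x i ^+ 2 + x j ^+ 2) / 2] in absolute value, and by
    symmetry both halves equal the sum of the squares of the entries of [x]
    weighted by the absolute row sums. *)
Lemma gershgorin_psd S c : S^T = S ->
  (forall i, abs_row_sum S i <= c) -> psd (c%:M + S).
Proof.
move=> symS rowS x; rewrite qformD qform_scalar qformE.
have symE i j : S i j = S j i by rewrite -[in LHS]symS mxE.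
pose W := \sum_i \sum_j `|S i j| * x i 0 ^+ 2.
have W_le : W <= c * \sum_i x i 0 ^+ 2.
  rewrite mulr_sumr; apply: ler_sum => i _.
  by rewrite -mulr_suml ler_wpM2r ?sqr_ge0//; exact: rowS.
have W_sym : W = \sum_i \sum_j `|S i j| * x j 0 ^+ 2.
  rewrite /W exchange_big; apply: eq_bigr => i _; apply: eq_bigr => j _.
  by rewrite symE.
suff : 0 <= W + W + 2 * \sum_i \sum_j S i j * (x i 0 * x j 0) by lra.
rewrite {2}W_sym mulr_sumr /W -!big_split /=; apply: sumr_ge0 => i _.
rewrite mulr_sumr -!big_split /=; apply: sumr_ge0 => j _.
have [S0|S0] := leP 0 (S i j).
  by rewrite ger0_norm//; have := sqr_ge0 (x i 0 + x j 0); nra.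
by rewrite ltr0_norm//; have := sqr_ge0 (x i 0 - x j 0); nra.
Qed.

(** [c - P^T A P = P^T (c - A) P + c (1 - P^T P)]: an upper bound on a form
    survives a change of variable that does not increase the norm. *)
Lemma psd_compression A c P :
  psd A -> psd (c%:M - A) -> 0 <= c -> psd (1%:M - P^T *m P) ->
  psd (c%:M - P^T *m A *m P).
Proof.
move=> hA hcA c0 hP.
have -> : c%:M - P^T *m A *m P =
    P^T *m (c%:M - A) *m P + c *: (1%:M - P^T *m P).
  rewrite mulmxBr mulmxBl mul_mx_scalar -scalemxAl scalerBr scalemx1.
  by rewrite [RHS]addrC subrKA.
by apply: psdD; [exact: psd_congr | exact: psdZ].
Qed.

End PositiveSemidefinite.

Lemma psd_shift_unit {R : realFieldType} {n : nat} (A : 'M[R]_n) a :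
  0 < a -> psd (A - a%:M) -> A \in unitmx.
Proof.
move=> a0 hA; rewrite -unitmx_tr -row_free_unit; apply/inj_row_free => v.
move=> /(congr1 trmx); rewrite trmx_mul trmxK trmx0 => Av0.
have := hA v^T; rewrite qformD qformN qform_scalar /qform -mulmxA Av0.
rewrite mulmx0 mxE add0r oppr_ge0 pmulr_rle0// => sum_le0.
have /eqP : \sum_i v^T i 0 ^+ 2 = 0.
  by apply/le_anti/andP; split => //; apply: sumr_ge0 => i _; exact: sqr_ge0.
rewrite psumr_eq0 => [/allP v0|i _]; last exact: sqr_ge0.
apply/rowP => j; have /implyP/(_ isT) := v0 j (mem_index_enum _).
by rewrite sqrf_eq0 !mxE => /eqP.
Qed.

(** * Limits of sequences of matrices *)

Section MatrixLimits.
Context {R : realType}.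

Lemma cvg_mx_entries (m n : nat) (u : nat -> 'M[R]_(m, n)) (l : 'M[R]_(m, n)) :
  (forall i j, u k i j @[k --> \oo] --> l i j) -> u @ \oo --> l.
Proof.
move=> ucvg; apply/cvg_mx_entourageP => E entE.
suff : \forall k \near \oo, forall i j, E (l i j, u k i j).
  by apply: filterS => k Ek i j; rewrite inE.
apply: filter_forall => i; apply: filter_forall => j.
have /cvg_app_entourageP := ucvg i j; exact.
Qed.

Lemma cvg_mulmx0 (m n p : nat) (A : 'M[R]_(m, n)) (u : nat -> 'M[R]_(n, p)) :
  u @ \oo --> (0 : 'M[R]_(n, p)) -> A *m u k @[k --> \oo] --> (0 : 'M[R]_(m, p)).
Proof.
move=> u0; apply: cvg_mx_entries => i j.
have -> : (0 : 'M[R]_(m, p)) i j = \sum_h A i h * (0 : 'M[R]_(n, p)) h j.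
  by rewrite mxE big1// => h _; rewrite mxE mulr0.
have -> : (fun k => (A *m u k) i j) = (fun k => \sum_h A i h * u k h j).
  by apply/funext => k; rewrite mxE.
apply: cvg_big => [|h _]; first exact: add_continuous.
apply: cvgM; first exact: cvg_cst.
exact: (cvg_comp _ _ u0 (@coord_continuous R n p h j 0)).
Qed.

Lemma cvg_sqnorm0 (n : nat) (u : nat -> 'cV[R]_n) :
  \sum_i u k i 0 ^+ 2 @[k --> \oo] --> 0 -> u @ \oo --> (0 : 'cV[R]_n).
Proof.
move=> u0; apply: cvg_mx_entries => i j; rewrite ord1 mxE.
apply/cvgr0Pnorm_lt => e e0.
have /cvgr0_norm_lt/(_ (e ^+ 2)) := u0; rewrite exprn_gt0// => /(_ isT).
apply: filterS => k; rewrite ger0_norm; last first.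
  by apply: sumr_ge0 => h _; exact: sqr_ge0.
move=> lt_e; rewrite -(@ltr_pXn2r _ 2)// ?nnegrE ?ltW//.
apply: le_lt_trans lt_e; rewrite real_normK ?num_real//.
by rewrite (bigD1 i)//= lerDl sumr_ge0// => h _; exact: sqr_ge0.
Qed.

End MatrixLimits.

(** * Convergence of a splitting by an energy argument *)

(** A quantitative form of the Householder-John theorem on P-regular
    splittings: the energy of the error for [A - B] drops at each step by the
    value of [A + B] on the increment, so the increments tend to 0, and they
    control the errors. *)
Lemma iteration_converges_of_psd {R : realType} {n : nat} (A B : 'M[R]_n) a b :
  0 < a -> 0 < b -> (A - B)^T = A - B ->
  psd (A - B - a%:M) -> psd (A + B - b%:M) -> iteration_converges A B.
Proof.
move=> a0 b0 symS hS hT.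
pose S := A - B.
have S_unit : S \in unitmx := psd_shift_unit _ a a0 hS.
(* [A] is the mean of [A - B] and [A + B], hence bounded below as well. *)
have A_unit : A \in unitmx.
  apply: (@psd_shift_unit _ _ _ (2^-1 * (a + b))); first by rewrite mulr_gt0 ?addr_gt0.
  have -> : A - (2^-1 * (a + b))%:M =
      2^-1 *: ((A - B - a%:M) + (A + B - b%:M)).
    apply/matrixP => i j; rewrite !mxE; case: (i == j); lra.
  by apply: psdZ; [rewrite invr_ge0 | exact: psdD].
move=> g u0.
pose u k := iter k (fun v => invmx A *m (B *m v + g)) u0.
have uS k : A *m u k.+1 = B *m u k + g by rewrite /u iterS mulKVmx.
exists u; split.
  split; first by split.
  move=> v [v0 vS]; apply/funext; elim=> [|k IHk]; first by rewrite v0.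
  by apply: (can_inj (mulKmx A_unit)); rewrite uS vS IHk.
(* [l] is the fixed point of the iteration, hence the limit to be reached. *)
pose l := invmx S *m g.
have Sl : S *m l = g by rewrite mulKVmx.
pose e k := u k - l.
pose d k := u k.+1 - u k.
have eS k : e k.+1 = e k + d k by rewrite /e /d [RHS]addrC subrKA.
have Ad k : S *m e k = - (A *m d k).
  by rewrite /e /d !mulmxBr Sl uS /S mulmxBl; apply/matrixP => i j; rewrite !mxE; ring.
pose E k := qform S (e k).
have E_drop k : E k - E k.+1 = qform (A + B) (d k).
  rewrite /E eS (qform_add S (e k) (d k) symS) -mulmxA Ad mulmxN mxE mulmxA.
  rewrite -/(qform A (d k)) /S !qformD !qformN; ring.
have E_ge0 k : 0 <= E k.
  by have := psdD _ _ hS (psd_scalar _ (ltW a0)) (e k); rewrite subrK.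
have d_le k : b * \sum_i d k i 0 ^+ 2 <= E k - E k.+1.
  by have := hT (d k); rewrite E_drop qformD qformN qform_scalar subr_ge0.
have E_cvg : cvgn E.
  apply: nonincreasing_is_cvgn.
    apply/nonincreasing_seqP => k; rewrite -subr_ge0; apply: le_trans (d_le k).
    by rewrite mulr_ge0 ?(ltW b0)// sumr_ge0// => i _; exact: sqr_ge0.
  by exists 0 => _ [k _ <-].
have d0 : d @ \oo --> (0 : 'cV[R]_n).
  apply: cvg_sqnorm0.
  apply: (@squeeze_cvgr _ _ _ _ (fun=> 0) (fun k => b^-1 * (E k - E k.+1))).
  - apply: nearW => k; rewrite ler_pdivlMl// d_le andbT.
    by apply: sumr_ge0 => i _; exact: sqr_ge0.
  - exact: cvg_cst.
  - rewrite -(mulr0 b^-1) -(subrr (limn E)); apply: cvgM; first exact: cvg_cst.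
    by apply: cvgB => //; rewrite (cvg_shiftS E).
have uE : u = (fun k => (- invmx S *m A) *m d k + l).
  apply/funext => k; rewrite -mulmxA mulNmx -mulmxN -Ad mulKmx//.
  by rewrite /e subrK.
rewrite uE; apply: is_cvgD; last exact: is_cvg_cst.
apply: cvgP; exact: (cvg_mulmx0 _ _ _ _ _ d0).
Qed.

(** The common form of the four iterations.  With [K = P^T M P] the splitting
    satisfies [A - B = a - t K] and [A + B = - 2 t M + (a + t K)], where [K]
    lies between [- c] and 0 because [M] does. *)
Lemma imex_iteration_converges {R : realType} {n : nat} (M P : 'M[R]_n)
    (a t c : R) :
  M^T = M -> psd (- M) -> psd (c%:M + M) -> psd (1%:M - P^T *m P) ->
  0 <= c -> 0 < a -> 0 < t -> t * c < a ->
  iteration_converges (a%:M - t *: M) (- (t *: (M - P^T *m M *m P))).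
Proof.
move=> symM hM hcM hP c0 a0 t0 lt_a.
have hPMP : psd (P^T *m (- M) *m P) by exact: psd_congr.
have hcPMP : psd (c%:M - P^T *m (- M) *m P).
  by apply: psd_compression; rewrite ?opprK.
have symK : (P^T *m M *m P)^T = P^T *m M *m P.
  by rewrite !trmx_mul trmxK symM mulmxA.
rewrite mulmxN mulNmx in hPMP hcPMP.
(* Making [K] opaque keeps the entrywise computations from expanding it. *)
move: (P^T *m M *m P) symK hPMP hcPMP => K symK hK hcK.
have entry_sym (Q : 'M[R]_n) i j : Q^T = Q -> Q i j = Q j i.
  by move=> symQ; rewrite -[in LHS]symQ mxE.
apply: (iteration_converges_of_psd _ _ a (a - t * c)) => //.
- by rewrite subr_gt0.
- apply/matrixP => i j; rewrite !mxE eq_sym.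
  by rewrite (entry_sym M)// (entry_sym K).
- have -> : a%:M - t *: M - - (t *: (M - K)) - a%:M = t *: - K.
    by apply/matrixP => i j; rewrite !mxE; ring.
  by apply: psdZ => //; exact: ltW.
- have -> : a%:M - t *: M + - (t *: (M - K)) - (a - t * c)%:M =
      (2 * t) *: (- M) + t *: (c%:M - - K).
    by apply/matrixP => i j; rewrite !mxE; case: (i == j); rewrite /=; ring.
  by apply: psdD; apply: psdZ => //; rewrite ?mulr_ge0 ?ltW.
Qed.

(** * Absolute row sums *)

Section RowSums.
Context {R : realDomainType}.

Lemma abs_row_sumD (m n : nat) (A B : 'M[R]_(m, n)) i :
  abs_row_sum (A + B) i <= abs_row_sum A i + abs_row_sum B i.
Proof.
by rewrite -big_split /=; apply: ler_sum => j _; rewrite mxE ler_normD.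
Qed.

Lemma abs_row_sum_tens (m n p q : nat) (A : 'M[R]_(m, n)) (B : 'M[R]_(p, q)) i :
  abs_row_sum (A *t B) i =
  abs_row_sum A (mxtens_unindex i).1 * abs_row_sum B (mxtens_unindex i).2.
Proof.
by rewrite /abs_row_sum mulr_sum; apply: eq_bigr => j _; rewrite mxE normrM.
Qed.

Lemma abs_row_sum1 (n : nat) (i : 'I_n) : abs_row_sum (1%:M : 'M[R]_n) i = 1.
Proof.
rewrite /abs_row_sum (bigD1 i)//= mxE eqxx normr1 big1 ?addr0// => j ji.
by rewrite mxE eq_sym (negbTE ji) normr0.
Qed.

Lemma sum_indicator_le1 (n : nat) (P : pred 'I_n) :
  {in P &, forall i j, i = j} -> \sum_j (P j)%:R <= 1 :> R.
Proof.
move=> P_inj; case: (pickP P) => [i Pi|P0]; last first.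
  by rewrite big1 ?ler01// => j _; rewrite P0.
rewrite (bigD1 i)//= Pi big1 ?addr0// => j ji.
by case: (boolP (P j)) => // Pj; rewrite (P_inj j i Pj Pi) eqxx in ji.
Qed.

End RowSums.

(** * Spectral bounds for the discrete Laplacian *)

Section DirichletLaplacian.
Context {R : realType}.

(** Adding [2 / d ^+ 2] cancels the diagonal; what is left is [1 / d ^+ 2]
    times the adjacency matrix of a path, in which a vertex has at most two
    neighbours. *)
Lemma laplace1d_row_sum (m : nat) (d : R) i : 0 < d ->
  abs_row_sum (laplace1d m d + (2 / d ^+ 2)%:M) i <= 2 / d ^+ 2.
Proof.
move=> d0.
apply: (@le_trans _ _ (\sum_(j < m)
    (d ^+ 2)^-1 * ((i.+1 == j :> nat)%:R + (j.+1 == i :> nat)%:R))).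
  apply: ler_sum => j _; rewrite !mxE; case: eqVneq => [<-|ij].
    rewrite mulr1n mulrN [2 / _]mulrC addNr normr0.
    by rewrite mulr_ge0 ?invr_ge0 ?sqr_ge0// addr_ge0.
  rewrite mulr0n addr0 normrM ger0_norm ?invr_ge0 ?sqr_ge0//.
  rewrite ler_wpM2l ?invr_ge0 ?sqr_ge0//.
  by case: eqP; case: eqP => _ _ /=; rewrite ?normr0 ?normr1; lra.
rewrite -mulr_sumr mulrC ler_pM2r ?invr_gt0 ?exprn_gt0// big_split /=.
have -> : 2 = 1 + 1 :> R by lra.
apply: lerD; apply: sum_indicator_le1 => j k /eqP jE /eqP kE; apply: val_inj => /=.
  by rewrite -jE -kE.
by apply: succn_inj; rewrite jE kE.
Qed.

Lemma laplace1d_sym (m : nat) (d : R) : (laplace1d m d)^T = laplace1d m d.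
Proof. by apply/matrixP => i j; rewrite !mxE eq_sym orbC. Qed.

Variables (Lx Ly : R) (mx my : nat).
Hypotheses (Lx_gt0 : 0 < Lx) (Ly_gt0 : 0 < Ly).
Let dx : R := gridstep Lx mx.
Let dy : R := gridstep Ly my.
Let M := dirichlet_laplacian Lx Ly mx my.

Lemma gridstep_gt0 (L : R) m : 0 < L -> 0 < gridstep L m.
Proof. by move=> L0; rewrite divr_gt0. Qed.

Lemma dirichlet_laplacian_sym : M^T = M.
Proof. by rewrite /M linearD /= !trmx_tens !trmx1 !laplace1d_sym. Qed.

(** The two halves of the shift are absorbed by the two one-dimensional
    factors, since an identity tensor a scalar matrix is scalar; absolute row
    sums are multiplicative for tensor products. *)
Lemma dirichlet_laplacian_shift :
  M + (2 / dx ^+ 2 + 2 / dy ^+ 2)%:M =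
  1%:M *t (laplace1d mx dx + (2 / dx ^+ 2)%:M)
  + (laplace1d my dy + (2 / dy ^+ 2)%:M) *t 1%:M.
Proof.
apply/matrixP => p q; case: (mxtens_indexP p) => i k; case: (mxtens_indexP q) => j l.
rewrite !mxE !mxtens_indexK /= (can_eq (@mxtens_indexK _ _)) xpair_eqE.
by case: (i == j); case: (k == l) => /=; ring.
Qed.

Let c0 : R := 2 / dx ^+ 2 + 2 / dy ^+ 2.

Lemma dirichlet_laplacian_row_sum p : abs_row_sum (M + c0%:M) p <= c0.
Proof.
rewrite dirichlet_laplacian_shift; apply: (le_trans (abs_row_sumD _ _ _ _ _)).
rewrite !abs_row_sum_tens !abs_row_sum1 mul1r mulr1.
by apply: lerD; apply: laplace1d_row_sum; exact: gridstep_gt0.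
Qed.

(** The Gershgorin bound for [S = M + c0] and for [- S] reads
    [0 <= - M <= 2 c0], and [2 c0 = 4 / dx ^+ 2 + 4 / dy ^+ 2 <= 8 / h ^+ 2]. *)
Lemma dirichlet_laplacian_psd (h := Num.min dx dy) :
  psd (- M) /\ psd ((8 / h ^+ 2)%:M + M).
Proof.
have dx0 : 0 < dx by exact: gridstep_gt0.
have dy0 : 0 < dy by exact: gridstep_gt0.
have h0 : 0 < h by rewrite lt_min dx0 dy0.
have symS : (M + c0%:M)^T = M + c0%:M.
  by rewrite linearD /= tr_scalar_mx dirichlet_laplacian_sym.
split.
  have -> : - M = c0%:M + - (M + c0%:M) by rewrite [- (M + _)]opprD [RHS]addrC subrK.
  apply: gershgorin_psd => [|p]; first by rewrite linearN /= symS.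
  apply: le_trans (dirichlet_laplacian_row_sum p).
  by apply: ler_sum => q _; rewrite mxE normrN.
have -> : (8 / h ^+ 2)%:M + M =
    (8 / h ^+ 2 - (c0 + c0))%:M + (c0%:M + (M + c0%:M)).
  by apply/matrixP => p q; rewrite !mxE; ring.
apply: psdD; last exact: gershgorin_psd symS dirichlet_laplacian_row_sum.
apply: psd_scalar.
have step_le d : 0 < d -> h <= d -> 2 / d ^+ 2 <= 2 / h ^+ 2.
  move=> d0 hd; rewrite ler_pM2l// lef_pV2 ?posrE ?exprn_gt0//.
  by rewrite lerXn2r// nnegrE ltW.
have hx : h <= dx by rewrite ge_min lexx.
have hy : h <= dy by rewrite ge_min lexx orbT.
have := step_le dx dx0 hx; have := step_le dy dy0 hy.
rewrite /c0; lra.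
Qed.

(** * The matrix of the hole couplings *)

(** A node outside the holes must lie in [hatOmega]; otherwise its couplings
    would be missing from [calN1]. *)
Lemma node_in_Omega (p : 'I_(my * mx)) : node Lx Ly p \in Omega Lx Ly.
Proof.
have bound (L : R) m (i : 'I_m) : 0 < L -> 0 <= i.+1%:R * gridstep L m <= L.
  move=> L0; rewrite mulr_ge0 ?(ltW (gridstep_gt0 L m L0))//=.
  rewrite /gridstep mulrCA ger_pMr// ler_pdivrMr// mul1r ler_nat.
  by rewrite ltnS ltnW.
rewrite inE; split; rewrite /= in_itv /=.
  exact: (bound Lx mx (mxtens_unindex p).2).
exact: (bound Ly my (mxtens_unindex p).1).
Qed.

Variable Theta : set (R * R).

Definition outside_projection : 'M[R]_(my * mx) :=
  diag_mx (\row_p (node Lx Ly p \notin Theta)%:R).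

(** The couplings removed from [M] are those between two nodes outside the
    holes. *)
Lemma calNE : calN Lx Ly mx my Theta =
  M - outside_projection^T *m M *m outside_projection.
Proof.
rewrite tr_diag_mx; apply/matrixP => p q.
rewrite mul_mx_diag mul_diag_mx !mxE in_setD node_in_Omega /=.
rewrite -/M; case: (node Lx Ly p \in Theta); case: (node Lx Ly q \in Theta) => /=; ring.
Qed.

Lemma outside_projection_contraction :
  psd (1%:M - outside_projection^T *m outside_projection).
Proof.
move=> x; rewrite -[_^T *m _](mulmx1) -mulmxA mulmx1 -{1}(mulmx1 _^T).
rewrite qformD qformN qform_congr !qform_scalar !mul1r subr_ge0.
apply: ler_sum => p _; rewrite mul_diag_mx !mxE.
by case: (_ \notin _); rewrite ?mul1r// mul0r expr0n sqr_ge0.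
Qed.

End DirichletLaplacian.

Theorem theorem3 (R : realType) (Lx Ly : R) (mx my : nat)
    (Theta : set (R * R)) (Dphi Dc w dt : R)
    (Lx_gt0 : 0 < Lx) (Ly_gt0 : 0 < Ly)
    (Theta_int : Theta `<=` interior (Omega Lx Ly))
    (Theta_node : exists p : 'I_(my * mx), Theta (node Lx Ly p))
    (Dphi_gt0 : 0 < Dphi) (Dc_gt0 : 0 < Dc) (w_gt0 : 0 < w) (dt_gt0 : 0 < dt) :
  let h := Num.min (gridstep Lx mx) (gridstep Ly my) in
  let M := dirichlet_laplacian Lx Ly mx my in
  let N := calN Lx Ly mx my Theta in
  (step_condition 1 h Dphi Dc w dt -> euler_converges M N Dphi Dc w dt)
  /\ (step_condition (3 / 2) h Dphi Dc w dt ->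
      sbdf2_converges M N Dphi Dc w dt).
Proof.
move=> h M N.
have h0 : 0 < h ^+ 2 by rewrite exprn_gt0// lt_min !gridstep_gt0.
have wdt0 : 0 < w * dt by rewrite mulr_gt0.
have conv a t : 0 < a -> 0 < t -> 8 * t < a * h ^+ 2 ->
    iteration_converges (a%:M - t *: M) (- (t *: N)).
  move=> a0 t0 lt_a; rewrite /N calNE//.
  have [hM hcM] := dirichlet_laplacian_psd Lx Ly mx my Lx_gt0 Ly_gt0.
  apply: (imex_iteration_converges _ _ _ _ (8 / h ^+ 2)) => //.
  - exact: dirichlet_laplacian_sym.
  - exact: outside_projection_contraction.
  - by rewrite divr_ge0 ?ltW.
  - by rewrite mulrA ltr_pdivrMr// mulrC.
(* Both alternatives give [dt (8 Dphi - w h ^+ 2) < gamma h ^+ 2]: the first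
   makes the left-hand side negative, the second is this inequality divided by
   a positive denominator. *)
have phi_step gamma : 0 < gamma ->
    8 * Dphi / w < h ^+ 2 \/ dt < gamma * h ^+ 2 / (8 * Dphi - w * h ^+ 2) ->
    8 * (dt * Dphi) < (gamma + w * dt) * h ^+ 2.
  move=> g0 [|].
    rewrite ltr_pdivrMr// => lt_h.
    have := ltr_pM2l dt_gt0 (8 * Dphi) (h ^+ 2 * w); rewrite lt_h => lt_dt.
    have := mulr_gt0 g0 h0; lra.
  have [den0|den0] := ltP 0 (8 * Dphi - w * h ^+ 2).
    by rewrite ltr_pdivlMr//; lra.
  (* With a nonpositive denominator the bound on [dt] is at most 0. *)
  move=> lt_dt; exfalso; move: (lt_trans dt_gt0 lt_dt); apply/negP.
  by rewrite -leNgt mulr_ge0_le0 ?invr_le0// mulr_ge0 ?ltW.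
have c_step gamma : dt < gamma * h ^+ 2 / (8 * Dc) ->
    8 * (dt * Dc) < gamma * h ^+ 2.
  by rewrite ltr_pdivlMr ?mulr_gt0//; lra.
split=> -[/phi_step phi_lt /c_step c_lt]; split; apply: conv;
  rewrite ?addr_gt0 ?mulr_gt0//; lra.
Qed.
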